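(* Let $\Lambda$ be a lattice with basis $u_1,\dots,u_n$ and let $f,g$ be polynomials on $\Lambda$. The map sending $T^{u_i}\mapsto 1+\partial_{u_i}$ for all $i$ defines an isomorphism $K_f\cong A_g$ if and only if $f\sim\mathrm{Poch}^{\downarrow}(g)$. Likewise, the map sending $T^{u_i}\mapsto\frac{1}{1-\partial_{u_i}}$ for all $i$ defines an isomorphism $K_f\cong A_g$ if and only if $f\sim\mathrm{Poch}^{\uparrow}(g)$.
   Context: A lattice is a free abelian group of finite rank; ''polynomial on $\Lambda$'' means a polynomial function $\Lambda\to\mathbb{Q}$ with rational coefficients, and $P(\Lambda)=\mathbb{Q}[x_1,\dots,x_n]$ is the ring of these, with $x_1,\dots,x_n$ the coordinates dual to $u_1,\dots,u_n$. $\mathrm{Sh}(\Lambda)=\mathbb{Z}[\Lambda]$ is the group ring with basis $T^u$, acting by $(T^uh)(x)=h(x+u)$; $\mathrm{Diff}(\Lambda)=\mathbb{Z}[\partial_{u_1},\dots,\partial_{u_n}]$ is the ring of constant-coefficient differential operators with integer coefficients, $\partial_{u_i}=\partial/\partial x_i$. $K_f=\mathrm{Sh}(\Lambda)/\mathrm{Ann}(f)$, $A_g=\mathrm{Diff}(\Lambda)/\mathrm{Ann}(g)$ ($\mathrm{Ann}$: ideal of operators killing the polynomial). The classes $[\partial_{u_i}]\in A_g$ are nilpotent, so $1+[\partial_{u_i}]$ and $1-[\partial_{u_i}]$ are units and each assignment determines a ring homomorphism $\mathrm{Sh}(\Lambda)\to A_g$; it ''defines an isomorphism $K_f\cong A_g$''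 if it factors through $K_f$ and the induced map is an isomorphism. Two polynomials $f,h\in P(\Lambda)$ are differentially equivalent, $f\sim h$, if $\mathrm{Ann}_{\mathrm{Diff}(\Lambda)}(f)=\mathrm{Ann}_{\mathrm{Diff}(\Lambda)}(h)$; equivalently, $f=\alpha\cdot h$ for some unit $\alpha\in(\mathbb{Q}\otimes A_h)^\times$. The falling/rising Pochhammer transforms $\mathrm{Poch}^{\downarrow},\mathrm{Poch}^{\uparrow}\colon P(\Lambda)\to P(\Lambda)$ are the $\mathbb{Q}$-linear maps replacing powers by factorials: $\mathrm{Poch}^{\downarrow}(\prod_i x_i^{k_i})=\prod_i x_i(x_i-1)\cdots(x_i-k_i+1)$ and $\mathrm{Poch}^{\uparrow}(\prod_i x_i^{k_i})=\prod_i x_i(x_i+1)\cdots(x_i+k_i-1)$. *)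

(* Defs.v *)
From HB Require Import structures.
From mathcomp Require Import all_boot all_order all_algebra.
From mathcomp.multinomials Require Import freeg mpoly.

Set Implicit Arguments.
Unset Strict Implicit.
Unset Printing Implicit Defensive.

Import GRing.Theory.
Import Quotient.Exports.

Local Open Scope ring_scope.
Local Open Scope quotient_scope.

(* A zmodType L with such a basis is a lattice of rank n; the bcoord _ i are the
   integer coordinates x_i dual to the basis. *)
Record lattice_basis (n : nat) (L : zmodType) := LatticeBasis {
  bvec :> 'I_n -> L;
  bcoord : L -> 'I_n -> int;
  bvec_decomp : forall v, v = \sum_i bvec i *~ bcoord v i;
  bcoord_dual : forall (c : 'I_n -> int) i,
    bcoord (\sum_j bvec j *~ c j) i = c i
}.

Section Basis.
Variables (n : nat) (L : zmodType) (b : lattice_basis n L).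

Lemma bcoordD v w i : bcoord b (v + w) i = bcoord b v i + bcoord b w i.
Proof.
rewrite {1}(bvec_decomp b v) {1}(bvec_decomp b w) -big_split /=.
under eq_bigr do rewrite -mulrzDr.
exact: (bcoord_dual b (fun j => bcoord b v j + bcoord b w j)).
Qed.

Lemma bcoord0 i : bcoord b 0 i = 0.
Proof. by apply: (addrI (bcoord b 0 i)); rewrite -bcoordD !addr0. Qed.
End Basis.

Section Support.
Variables (K : eqType) (V : zmodType).

Lemma big_supp (s t : seq K) (F : K -> V) :
    uniq s -> uniq t -> {subset s <= t} ->
    (forall k, k \notin s -> F k = 0) ->
  \sum_(k <- s) F k = \sum_(k <- t) F k.
Proof.
move=> us ut st F0; rewrite [RHS](bigID (fun k => k \in s)) /= [X in _ + X]big1 //.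
rewrite addr0 -[RHS]big_filter; apply: perm_big; apply: uniq_perm => //.
  by rewrite filter_uniq.
move=> k; rewrite mem_filter; case ks: (k \in s) => //=.
by rewrite st.
Qed.
End Support.

Section FreegLift.
Variables (K : choiceType) (V : zmodType) (F : K -> V).

Definition fgsum (a : {freeg K / int}) : V :=
  \sum_(k <- dom a) F k *~ coeff k a.

Lemma fgsumE a : fgsum a = \sum_(k <- dom a) F k *~ coeff k a.
Proof. by []. Qed.

Lemma fgsum_is_zmod_morphism : zmod_morphism fgsum.
Proof.
move=> a c; pose t := undup (dom (a - c) ++ dom a ++ dom c).
have E (e : {freeg K / int}) : {subset dom e <= t} ->
    fgsum e = \sum_(k <- t) F k *~ coeff k e.
  move=> st; apply: big_supp => //; rewrite ?uniq_dom ?undup_uniq //.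
  by move=> k /coeff_outdom ->.
have sub : {subset dom a <= t} /\ {subset dom c <= t}.
  by split=> k kin; rewrite mem_undup !mem_cat kin !orbT.
rewrite !E ?sub.1 ?sub.2 //; try exact: sub.1; try exact: sub.2; last first.
  by move=> k kin; rewrite mem_undup !mem_cat kin.
by rewrite -sumrB; apply: eq_bigr => k _; rewrite coeffB mulrzBr.
Qed.

HB.instance Definition _ :=
  GRing.isZmodMorphism.Build {freeg K / int} V fgsum fgsum_is_zmod_morphism.

Lemma fgsumU k : fgsum << k >> = F k.
Proof. by rewrite /fgsum domU1 big_seq1 coeffU eqxx mulr1 mulr1z. Qed.
End FreegLift.

Lemma zmod_morphismD (U V : zmodType) (p : U -> V) :
  zmod_morphism p -> {morph p : x y / x + y}.
Proof.
move=> hp x y; have p0 : p 0 = 0 by rewrite -(subrr 0) hp subrr.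
have pN z : p (- z) = - p z by rewrite -[- z]sub0r hp p0 sub0r.
by rewrite -{1}[y]opprK hp pN opprK.
Qed.

Lemma freeg_morph_ext (K : choiceType) (V : zmodType)
    (p q : {freeg K / int} -> V) : zmod_morphism p -> zmod_morphism q ->
  (forall k, p << k >> = q << k >>) -> p =1 q.
Proof.
move=> hp hq pq a.
pose mp := GRing.isZmodMorphism.Build _ _ p hp.
pose mq := GRing.isZmodMorphism.Build _ _ q hq.
pose P : {additive _ -> _} := HB.pack p mp.
pose Q : {additive _ -> _} := HB.pack q mq.
rewrite -[p]/(P : _ -> _) -[q]/(Q : _ -> _) -[a]freeg_sumE !raddf_sum.
apply: eq_bigr => k _.
rewrite -[coeff k a]intz -freegU_mulz !raddfMz.
by congr (_ *~ _); exact: pq.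
Qed.

(* Z[L] as finitely supported functions L -> int, with the convolution product
   below.  (The monoid algebras {malg _[_]} require a monoid without nontrivial
   units, which excludes groups.) *)
Definition Sh (L : zmodType) : Type := {freeg L / int}.
HB.instance Definition _ (L : zmodType) := GRing.Zmodule.on (Sh L).

Section GroupRing.
Variable L : zmodType.
Implicit Types (a c : Sh L) (v w : L).

Definition Tr v : Sh L := << v >>.

(* The biadditive extension of T^v * T^w = T^(v + w). *)
Definition sh_mul a c : Sh L :=
  fgsum (fun v => fgsum (fun w => Tr (v + w)) c) a.

Lemma sh_mulUU v w : sh_mul (Tr v) (Tr w) = Tr (v + w).
Proof. by rewrite /sh_mul !fgsumU. Qed.

Lemma sh_mulBl c : zmod_morphism (sh_mul^~ c).
Proof. by move=> a a'; rewrite /sh_mul raddfB. Qed.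

Lemma sh_mulBr a : zmod_morphism (sh_mul a).
Proof.
move=> c c'; rewrite /sh_mul ![fgsum _ a]fgsumE -sumrB.
by apply: eq_bigr => v _; rewrite raddfB mulrzBl.
Qed.

Lemma sh_ext (V : zmodType) (p q : Sh L -> V) :
  zmod_morphism p -> zmod_morphism q -> (forall v, p (Tr v) = q (Tr v)) -> p =1 q.
Proof. exact: freeg_morph_ext. Qed.

Lemma sh_mulC : commutative sh_mul.
Proof.
move=> a c; move: a; apply: sh_ext (sh_mulBl c) (sh_mulBr c) _ => v.
move: c; apply: sh_ext (sh_mulBr _) (sh_mulBl _) _ => w.
by rewrite !sh_mulUU addrC.
Qed.

Lemma sh_mulA : associative sh_mul.
Proof.
move=> x y z; move: x; apply: sh_ext => [x x'|x x'|u].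
- exact: sh_mulBl.
- by rewrite !sh_mulBl.
move: y; apply: sh_ext => [y y'|y y'|v].
- by rewrite sh_mulBl sh_mulBr.
- by rewrite sh_mulBr sh_mulBl.
move: z; apply: sh_ext => [z z'|z z'|w].
- by rewrite !sh_mulBr.
- by rewrite !sh_mulBr.
by rewrite !sh_mulUU addrA.
Qed.

Lemma sh_mul1 : left_id (Tr 0) sh_mul.
Proof.
move=> a; move: a; apply: sh_ext => [||v] //; first exact: sh_mulBr.
by rewrite sh_mulUU add0r.
Qed.

Lemma sh_mulDl : left_distributive sh_mul +%R.
Proof.
by move=> x y z; apply: (zmod_morphismD (sh_mulBl z)).
Qed.

Lemma sh_oner_neq0 : Tr 0 != 0.
Proof. by rewrite freegU_eq0 oner_eq0. Qed.

HB.instance Definition _ := GRing.Zmodule_isComNzRing.Build (Sh L)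
  sh_mulA sh_mulC sh_mul1 sh_mulDl sh_oner_neq0.

Lemma Tr0 : Tr 0 = 1.
Proof. by []. Qed.

Lemma TrD v w : Tr (v + w) = Tr v * Tr w.
Proof. by rewrite -sh_mulUU. Qed.
End GroupRing.

(* P(L) = Q[x_1, ..., x_n], given its Sh(L)-module structure: T^v acts by
   h(x) |-> h(x + v).  The copy of {mpoly rat[n]} is named so that this scaling
   does not compete with the one by rat. *)
Definition poly_sh n L (b : lattice_basis n L) : Type := {mpoly rat[n]}.
HB.instance Definition _ n L (b : lattice_basis n L) :=
  GRing.Zmodule.on (poly_sh b).

Section ShAction.
Variables (n : nat) (L : zmodType) (b : lattice_basis n L).

Definition shift (v : L) (h : {mpoly rat[n]}) : {mpoly rat[n]} :=
  h \mPo [tuple 'X_i + ((bcoord b v i)%:~R)%:MP | i < n].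

Definition point (v : L) (i : 'I_n) : rat := (bcoord b v i)%:~R.

(* shift v is translation of polynomial functions on L. *)
Lemma shift_eval v h w : (shift v h).@[point w] = h.@[point (w + v)].
Proof.
rewrite /shift comp_mpoly_meval; apply: meval_eq => i.
by rewrite tnth_mktuple mevalD mevalXU mevalC /point bcoordD intrD.
Qed.

Definition sh_act (s : Sh L) (h : poly_sh b) : poly_sh b :=
  fgsum (fun v => shift v h) s.

Lemma shift0 h : shift 0 h = h.
Proof.
rewrite /shift -[RHS]comp_mpoly_id; congr (_ \mPo _).
by apply: eq_from_tnth => i; rewrite !tnth_mktuple bcoord0 mpolyC0 addr0.
Qed.

Lemma shiftD v w h : shift (v + w) h = shift v (shift w h).
Proof.
rewrite /shift; set tw := [tuple _ + (bcoord b w i)%:~R%:MP | i < n].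
rewrite (comp_mpolyEX h tw) [LHS]comp_mpolyEX raddf_sum /=.
apply: eq_bigr => m _; rewrite comp_mpolyZ; congr (_ *: _).
rewrite !comp_mpolyX rmorph_prod /=; apply: eq_bigr => i _.
rewrite rmorphXn /= !tnth_mktuple rmorphD /= comp_mpolyXU comp_mpolyC.
by rewrite -tnth_nth tnth_mktuple bcoordD intrD mpolyCD addrA.
Qed.

Lemma shiftB v : zmod_morphism (shift v).
Proof. by move=> p q; rewrite /shift raddfB. Qed.

Lemma sh_actBl h : zmod_morphism (sh_act^~ h).
Proof. by move=> s t; rewrite /sh_act raddfB. Qed.

Lemma sh_actBr s : zmod_morphism (sh_act s).
Proof.
move=> p q; rewrite /sh_act ![fgsum _ s]fgsumE -sumrB.
by apply: eq_bigr => v _; rewrite shiftB mulrzBl.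
Qed.

Lemma sh_actTr v h : sh_act (Tr v) h = shift v h.
Proof. exact: fgsumU. Qed.

Lemma sh_actA s t h : sh_act s (sh_act t h) = sh_act (s * t) h.
Proof.
move: s; apply: sh_ext => [s s'|s s'|v]; first by rewrite sh_actBl.
  by rewrite mulrBl sh_actBl.
move: t; apply: sh_ext => [t t'|t t'|w].
- by rewrite sh_actBl sh_actBr.
- by rewrite mulrBr sh_actBl.
by rewrite -TrD !sh_actTr shiftD.
Qed.

Lemma sh_act1 : left_id 1 sh_act.
Proof. by move=> h; rewrite -Tr0 sh_actTr shift0. Qed.

HB.instance Definition _ := GRing.Zmodule_isLmodule.Build (Sh L) (poly_sh b)
  sh_actA sh_act1 (fun s => zmod_morphismD (sh_actBr s))
  (fun h s t => zmod_morphismD (sh_actBl h) s t).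
End ShAction.

(* P(L) as a module over Diff(L) = Z[d_1, ..., d_n] = {mpoly int[n]}, where the
   variable 'X_i of Diff(L) acts by d/dx_i. *)
Definition poly_diff (n : nat) : Type := {mpoly rat[n]}.
HB.instance Definition _ n := GRing.Zmodule.on (poly_diff n).

Section DiffAction.
Variable n : nat.

Definition diff_act (d : {mpoly int[n]}) (h : poly_diff n) : poly_diff n :=
  \sum_(m <- msupp d) mderivm m (h : {mpoly rat[n]}) *~ d@_m.

Lemma diff_actBl h : zmod_morphism (diff_act^~ h).
Proof.
move=> d e; pose t := undup (msupp (d - e) ++ msupp d ++ msupp e).
have E c : {subset msupp c <= t} ->
    diff_act c h = \sum_(m <- t) mderivm m (h : {mpoly rat[n]}) *~ c@_m.
  move=> st; apply: big_supp => //; rewrite ?msupp_uniq ?undup_uniq //.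
  by move=> m /memN_msupp_eq0 ->.
have sub : {subset msupp d <= t} /\ {subset msupp e <= t}.
  by split=> m min; rewrite mem_undup !mem_cat min !orbT.
rewrite !E ?sub.1 ?sub.2 //; try exact: sub.1; try exact: sub.2; last first.
  by move=> m min; rewrite mem_undup !mem_cat min.
by rewrite -sumrB; apply: eq_bigr => m _; rewrite mcoeffB mulrzBr.
Qed.

Lemma diff_actBr d : zmod_morphism (diff_act d).
Proof.
move=> p q; rewrite /diff_act -sumrB.
by apply: eq_bigr => m _; rewrite raddfB mulrzBl.
Qed.

Lemma diff_actX m h : diff_act 'X_[m] h = mderivm m (h : {mpoly rat[n]}).
Proof. by rewrite /diff_act msuppX big_seq1 mcoeffX eqxx. Qed.

Lemma diff_ext (V : zmodType) (p q : {mpoly int[n]} -> V) :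
    zmod_morphism p -> zmod_morphism q ->
  (forall m, p 'X_[m] = q 'X_[m]) -> p =1 q.
Proof.
move=> hp hq pq d.
pose mp := GRing.isZmodMorphism.Build _ _ p hp.
pose mq := GRing.isZmodMorphism.Build _ _ q hq.
pose P : {additive _ -> _} := HB.pack p mp.
pose Q : {additive _ -> _} := HB.pack q mq.
rewrite -[p]/(P : _ -> _) -[q]/(Q : _ -> _) [d]mpolyE !raddf_sum.
apply: eq_bigr => m _.
by rewrite -[d@_m]intz scaler_int !raddfMz; congr (_ *~ _); exact: pq.
Qed.

Lemma diff_actA d e h : diff_act d (diff_act e h) = diff_act (d * e) h.
Proof.
move: d; apply: diff_ext => [d d'|d d'|m]; first by rewrite diff_actBl.
  by rewrite mulrBl diff_actBl.
move: e; apply: diff_ext => [e e'|e e'|m'].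
- by rewrite diff_actBl diff_actBr.
- by rewrite mulrBr diff_actBl.
by rewrite -mpolyXD !diff_actX addmC mderivmDm.
Qed.

Lemma diff_act1 : left_id 1 diff_act.
Proof. by move=> h; rewrite -mpolyX0 diff_actX mderivm0m. Qed.

HB.instance Definition _ :=
  GRing.Zmodule_isLmodule.Build {mpoly int[n]} (poly_diff n)
    diff_actA diff_act1 (fun d => zmod_morphismD (diff_actBr d))
    (fun h d e => zmod_morphismD (diff_actBl h) d e).
End DiffAction.

Section Annihilator.
Variables (R : comNzRingType) (M : lmodType R) (x : M).

Definition Ann : {pred R} := [pred r | r *: x == 0].

Lemma AnnE r : (r \in Ann) = (r *: x == 0).
Proof. by []. Qed.

Fact Ann_zmod_closed : zmod_closed Ann.
Proof.
split=> [|r s]; rewrite !AnnE ?scale0r // => /eqP r0 /eqP s0.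
by rewrite scalerBl r0 s0 subrr.
Qed.

HB.instance Definition _ := GRing.isZmodClosed.Build R Ann Ann_zmod_closed.

Lemma AnnM r s : s \in Ann -> r * s \in Ann.
Proof. by rewrite !AnnE => /eqP s0; rewrite -scalerA s0 scaler0. Qed.

(* R / Ann(x); it is the zero ring when x = 0, which is why its ring structure
   is built here and not taken from {ideal_quot _}, where ideals are proper. *)
Definition AnnQuot : Type := Quotient.quot Ann.
HB.instance Definition _ := GRing.Zmodule.on AnnQuot.
HB.instance Definition _ : EqQuotient R (Quotient.equiv Ann) AnnQuot :=
  EqQuotient.on AnnQuot.

Definition quo (r : R) : AnnQuot := \pi r.

Lemma quo_eq r s : (quo r == quo s) = (r - s \in Ann).
Proof. by rewrite /quo piE. Qed.

Lemma quo_surj q : quo (repr q) = q.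
Proof. exact: reprK. Qed.

Fact quo_is_zmod_morphism : zmod_morphism quo.
Proof.
by move=> r s; rewrite /quo (Quotient.pi_add Ann) (Quotient.pi_opp Ann).
Qed.

HB.instance Definition _ :=
  GRing.isZmodMorphism.Build R AnnQuot quo quo_is_zmod_morphism.

Definition aq_mul (p q : AnnQuot) : AnnQuot := quo (repr p * repr q).

Lemma quoM r s : quo (r * s) = aq_mul (quo r) (quo s).
Proof.
apply/eqP; rewrite quo_eq.
have dr : r - repr (quo r) \in Ann by rewrite -quo_eq quo_surj.
have ds : s - repr (quo s) \in Ann by rewrite -quo_eq quo_surj.
have -> : r * s - repr (quo r) * repr (quo s)
  = s * (r - repr (quo r)) + repr (quo r) * (s - repr (quo s)).
  by rewrite !mulrBr [s * r]mulrC [s * repr _]mulrC addrA subrK.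
by rewrite rpredD // AnnM.
Qed.

Fact aq_mulA : associative aq_mul.
Proof.
by move=> p q r; rewrite -[p]quo_surj -[q]quo_surj -[r]quo_surj -!quoM mulrA.
Qed.

Fact aq_mulC : commutative aq_mul.
Proof. by move=> p q; rewrite -[p]quo_surj -[q]quo_surj -!quoM mulrC. Qed.

Fact aq_mul1 : left_id (quo 1) aq_mul.
Proof. by move=> p; rewrite -[p]quo_surj -!quoM mul1r. Qed.

Fact aq_mulDl : left_distributive aq_mul +%R.
Proof.
move=> p q r; rewrite -[p]quo_surj -[q]quo_surj -[r]quo_surj.
by rewrite -raddfD -!quoM mulrDl raddfD.
Qed.

HB.instance Definition _ := GRing.Zmodule_isComPzRing.Build AnnQuot
  aq_mulA aq_mulC aq_mul1 aq_mulDl.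

Fact quo_is_monoid_morphism : monoid_morphism quo.
Proof. by split=> // r s; rewrite quoM. Qed.

HB.instance Definition _ :=
  GRing.isMonoidMorphism.Build R AnnQuot quo quo_is_monoid_morphism.
End Annihilator.

Definition Kf n L (b : lattice_basis n L) (f : {mpoly rat[n]}) : comPzRingType :=
  AnnQuot (f : poly_sh b).

Definition Ag n (g : {mpoly rat[n]}) : comPzRingType :=
  AnnQuot (g : poly_diff n).

Definition dcls n (g : {mpoly rat[n]}) (i : 'I_n) : Ag g :=
  quo (g : poly_diff n) 'X_i.

(* "T^{u_i} |-> a_i defines an isomorphism K_f -> A_g": phi is the unique ring
   homomorphism extending the assignment (Sh_rmorphism_ext), and psi the map it
   induces on the quotient. *)
Definition defines_iso n L (b : lattice_basis n L) (f g : {mpoly rat[n]})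
    (a : 'I_n -> Ag g) : Prop :=
  exists phi : {rmorphism Sh L -> Ag g},
    (forall i, phi (Tr (b i)) = a i) /\
    exists psi : {rmorphism Kf b f -> Ag g},
      (forall s, phi s = psi (quo (f : poly_sh b) s)) /\ bijective psi.

Definition diff_equiv n (f h : {mpoly rat[n]}) : Prop :=
  Ann (f : poly_diff n) =i Ann (h : poly_diff n).

Definition poch_fall n (p : {mpoly rat[n]}) : {mpoly rat[n]} :=
  \sum_(m <- msupp p) p@_m *: \prod_(i < n) \prod_(j < m i) ('X_i - j%:R).

Definition poch_rise n (p : {mpoly rat[n]}) : {mpoly rat[n]} :=
  \sum_(m <- msupp p) p@_m *: \prod_(i < n) \prod_(j < m i) ('X_i + j%:R).

Lemma Sh_rmorphism_ext n L (b : lattice_basis n L) (S : comPzRingType)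
    (p q : {rmorphism Sh L -> S}) :
  (forall i, p (Tr (b i)) = q (Tr (b i))) -> p =1 q.
Proof.
move=> pq.
pose P v := p (Tr v) = q (Tr v).
have PD v w : P v -> P w -> P (v + w) by rewrite /P TrD !rmorphM => -> ->.
have PN v : P v -> P (- v).
  rewrite /P => e; have h (r : {rmorphism Sh L -> S}) : r (Tr v) * r (Tr (- v)) = 1.
    by rewrite -rmorphM -TrD subrr Tr0 rmorph1.
  rewrite -[LHS]mulr1 -(h q) -e mulrA [p (Tr (- v)) * _]mulrC.
  by rewrite (h p) mul1r.
apply: sh_ext; [exact: raddfB|exact: raddfB|move=> v].
rewrite -/(P v) (bvec_decomp b v); elim/big_ind: _ => //.
  by rewrite /P Tr0 !rmorph1.
move=> i _.
have Pn k : P (b i *+ k).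
  elim: k => [|k IH]; first by rewrite /P Tr0 !rmorph1.
  by rewrite mulrS; apply: PD => //; exact: pq.
case: (bcoord b v i) => k; first exact: Pn.
by apply: PN; exact: Pn.
Qed.

(* Main.v *)
From HB Require Import structures.
Require Import Defs.
From mathcomp Require Import all_boot all_order all_algebra.
From mathcomp.multinomials Require Import ssrcomplements freeg mpoly.
From mathcomp Require Import ring.

Set Implicit Arguments.
Unset Strict Implicit.
Unset Printing Implicit Defensive.

Import GRing.Theory Num.Theory.
Local Open Scope ring_scope.

(* For e = 1 or -1 the Pochhammer transform P satisfies
   T^{e u_i} P = P (1 + e d_i), where d_i is differentiation along u_i.  Hence a
   ring homomorphism phi from Sh(L) to A_g with phi(T^{e u_i}) = 1 + e d_i
   satisfies s (P g) = P (phi(s) g); as P is injective, the kernel of phi is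
   Ann_Sh(P g), and phi is onto, so it induces an isomorphism K_f = A_g exactly
   when Ann_Sh(f) = Ann_Sh(P g).  It remains to see that f and h have the same
   annihilator in Sh(L) iff they have the same one in Diff(L).  On polynomials of
   bounded degree, shifts are rational combinations of derivatives by Taylor's
   formula, and conversely d_i is a rational combination of T^0, T^{u_i},
   T^{2 u_i}, ..., with weights obtained from a Vandermonde matrix; an
   annihilator is thus determined by the other one after clearing denominators. *)

(** * Taylor's formula along one coordinate direction *)

Section Taylor.
Variable n : nat.
Implicit Types (i : 'I_n) (c : rat) (h : {mpoly rat[n]}).

Definition translate i c h : {mpoly rat[n]} :=
  h \mPo [tuple 'X_j + ((i == j)%:R * c)%:MP | j < n].

HB.instance Definition _ i c := GRing.RMorphism.copy (translate i c)
  (comp_mpoly [tuple 'X_j + ((i == j)%:R * c)%:MP | j < n]).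
HB.instance Definition _ i c := GRing.Linear.copy (translate i c)
  (comp_mpoly [tuple 'X_j + ((i == j)%:R * c)%:MP | j < n]).

Lemma translateXU i c j : translate i c 'X_j = 'X_j + ((i == j)%:R * c)%:MP.
Proof. by rewrite /translate comp_mpolyXU -tnth_nth tnth_mktuple. Qed.

Lemma translateC i c a : translate i c a%:MP = a%:MP.
Proof. exact: comp_mpolyC. Qed.

(** The bound need not be sharp, so one [N] can serve several polynomials, zero included, and it
    survives differentiation. *)
Definition mdeg_lt N h := forall m : 'X_{1..n}, (N <= mdeg m)%N -> h@_m = 0.

Lemma mdeg_lt_msize h : mdeg_lt (msize h) h.
Proof. by move=> m le_hm; apply/memN_msupp_eq0/msize_mdeg_ge. Qed.

Lemma mdeg_lt_mderiv N i h : mdeg_lt N h -> mdeg_lt N h^`M(i).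
Proof.
move=> hN m le_Nm; rewrite mcoeff_mderiv hN ?mul0rn //.
by rewrite mdegD (leq_trans le_Nm) ?leq_addr.
Qed.

Lemma mdeg_lt_mderivm N m h : mdeg_lt N h -> mdeg_lt N h^`M[m].
Proof.
move=> hN m' le_Nm; rewrite mcoeff_mderivm hN ?mul0rn //.
by rewrite mdegD (leq_trans le_Nm) ?leq_addl.
Qed.

Lemma leq_mdeg i (m : 'X_{1..n}) : (m i <= mdeg m)%N.
Proof. by rewrite mdegE (bigD1 i) //= leq_addr. Qed.

Lemma mderivn_mdeg_lt N i h : mdeg_lt N h -> h^`M(i, N) = 0.
Proof.
move=> hN; apply/mpolyP=> m; rewrite mcoeff_mderivm mcoeff0 hN ?mul0rn //.
by rewrite mdegD mdegMn mdeg1 mul1n leq_addr.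
Qed.

Lemma translateX i c (m : 'X_{1..n}) :
  translate i c 'X_[m] =
    \sum_(k < (m i).+1) c ^+ k *+ 'C(m i, k) *: 'X_[m - U_(i) *+ k].
Proof.
rewrite /translate comp_mpolyX (bigD1 i) //= tnth_mktuple eqxx mul1r.
rewrite (eq_bigr (fun j => 'X_j ^+ m j)) => [|j ne_ji]; last first.
  by rewrite tnth_mktuple eq_sym (negbTE ne_ji) mul0r addr0.
rewrite exprDn mulr_suml; apply: eq_bigr => k _.
rewrite mulrnAl -rmorphXn /= mulrAC [_ * _%:MP]mulrC mul_mpolyC.
rewrite -scalerMnl; congr (_ *: _ *+ _).
rewrite [RHS]mpolyXE_id [RHS](bigD1 i) //=; congr (_ * _).
  by rewrite mnmBE mulmnE mnm1E eqxx mul1n.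
apply: eq_bigr => j ne_ji.
by rewrite mnmBE mulmnE mnm1E eq_sym (negbTE ne_ji) mul0n subn0.
Qed.

(** By linearity it suffices to treat monomials, where this is the binomial theorem: the k-th
    derivative produces the falling factorial ['C(m i, k) * k!]. *)
Lemma taylor N i c h : mdeg_lt N h ->
  translate i c h = \sum_(k < N) (c ^+ k / k`!%:R) *: h^`M(i, k).
Proof.
move=> hN; rewrite [h in LHS]mpolyE raddf_sum /=.
have -> : \sum_(k < N) (c ^+ k / k`!%:R) *: h^`M(i, k) =
    \sum_(k < N) \sum_(m <- msupp h)
      h@_m *: ((c ^+ k / k`!%:R) *: 'X_[m]^`M(i, k)).
  apply: eq_bigr => k _; rewrite [h in LHS]mpolyE raddf_sum scaler_sumr.
  by apply: eq_bigr => m _; rewrite /= mderivmZ !scalerA mulrC.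
rewrite exchange_big /= !big_seq; apply: eq_bigr => m m_h.
rewrite linearZ -scaler_sumr /= translateX; congr (_ *: _).
(* The binomial sum stops at [m i]; this bound lets it be padded to the common range [k < N], the
   extra derivatives being zero. *)
have lt_mN : (m i < N)%N.
  rewrite ltnNge; apply/negP => le_Nm; move: m_h; rewrite mcoeff_msupp hN ?eqxx //.
  exact: leq_trans le_Nm (leq_mdeg i m).
rewrite (big_ord_widen N (fun k => c ^+ k *+ 'C(m i, k) *: 'X_[m - U_(i) *+ k])) //.
rewrite big_mkcond /=; apply: eq_bigr => k _.
rewrite mderivnX scalerA; case: ltnP => [le_km|lt_mk]; last first.
  by rewrite ffact_small // mulr0 scale0r.
congr (_ *: _); rewrite -bin_ffact natrM -mulr_natr -mulrA; congr (_ * _).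
by rewrite mulrC mulfK // pnatr_eq0 -lt0n fact_gt0.
Qed.
End Taylor.

(** * Integer multiples, induction on integer polynomials, and degree bounds *)

Lemma zmod_morphism_mulrz (U V : zmodType) (p : U -> V) (c : int) (x : U) :
  zmod_morphism p -> p (x *~ c) = p x *~ c.
Proof.
move=> hp; pose mp := GRing.isZmodMorphism.Build _ _ p hp.
pose P : {additive _ -> _} := HB.pack p mp.
exact: (raddfMz P).
Qed.

Lemma zmod_morphism0 (U V : zmodType) (p : U -> V) : zmod_morphism p -> p 0 = 0.
Proof. by move=> hp; rewrite -(subrr 0) hp subrr. Qed.

Lemma mpoly_mulrz_eq0 n (h : {mpoly rat[n]}) c : c != 0 -> (h *~ c == 0) = (h == 0).
Proof. by move=> c0; rewrite -scaler_int scaler_eq0 intr_eq0 (negbTE c0). Qed.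

(** The variables generate the integer polynomials as a ring, so a subring containing them is
    everything; this serves to prove surjectivity onto A_g. *)
Lemma mpolyint_ind n (P : {mpoly int[n]} -> Prop) :
    P 1 -> (forall p q, P p -> P q -> P (p - q)) ->
    (forall p q, P p -> P q -> P (p * q)) -> (forall i, P 'X_i) ->
  forall p, P p.
Proof.
move=> P1 PB PM PX p.
have P0 : P 0 by rewrite -(subrr 1); apply: PB.
have PN q : P q -> P (- q) by move=> Pq; rewrite -sub0r; apply: PB.
have PD q r : P q -> P r -> P (q + r).
  by move=> Pq Pr; rewrite -[r]opprK; apply: PB => //; apply: PN.
elim/mpolyind: p => // c m p _ _ Pp; apply: (PD) => //.
have Pm : P 'X_[m].
  rewrite mpolyXE_id; elim/big_ind: _ => // i _.
  by elim: (m i) => [|k IH] //; rewrite exprS; apply: PM.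
have Pn k : P ('X_[m] *+ k).
  by elim: k => [|k IH] //; rewrite mulrS; apply: PD.
rewrite -[c]intz scaler_int; case: c => k; first exact: Pn.
by rewrite NegzE mulrNz; apply: PN; exact: Pn.
Qed.

Section MdegLt.
Variables (n N : nat).
Implicit Types h : {mpoly rat[n]}.

Lemma mdeg_lt0 : mdeg_lt N (0 : {mpoly rat[n]}).
Proof. by move=> m _; rewrite mcoeff0. Qed.

Lemma mdeg_ltD h h' : mdeg_lt N h -> mdeg_lt N h' -> mdeg_lt N (h + h').
Proof. by move=> hN hN' m Nm; rewrite mcoeffD hN // hN' // addr0. Qed.

Lemma mdeg_ltMz h c : mdeg_lt N h -> mdeg_lt N (h *~ c).
Proof. by move=> hN m Nm; rewrite raddfMz /= hN // mul0rz. Qed.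

Lemma mdeg_ltMz_inv h c : c != 0 -> mdeg_lt N (h *~ c) -> mdeg_lt N h.
Proof.
move=> c0 hN m /hN /eqP; rewrite raddfMz /= -mulrzr mulf_eq0 intr_eq0.
by rewrite (negbTE c0) orbF => /eqP.
Qed.
End MdegLt.

(** * Operators represented by ring elements in bounded degree *)

Section Realizable.
Variables (R : comNzRingType) (n : nat).
Variable act : R -> {mpoly rat[n]} -> {mpoly rat[n]}.
Hypothesis actBl : forall h, zmod_morphism (act^~ h).
Hypothesis actBr : forall r, zmod_morphism (act r).
Hypothesis actA : forall r s h, act r (act s h) = act (r * s) h.
Hypothesis act1 : forall h, act 1 h = h.
Variable N : nat.
Implicit Types (A B : {mpoly rat[n]} -> {mpoly rat[n]}) (h : {mpoly rat[n]}).

(* The denominator [c] lets the integral ring [R] stand for its rational span. *)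
Definition realizable A :=
  exists2 c : int, c != 0 &
    exists r, forall h, mdeg_lt N h -> act r h = A h *~ c.

Lemma realizable_ext A B :
  (forall h, mdeg_lt N h -> A h = B h) -> realizable A -> realizable B.
Proof.
by move=> AB [c c0 [r rA]]; exists c => //; exists r => h hN; rewrite rA // AB.
Qed.

Lemma realizable0 : realizable (fun=> 0).
Proof.
by exists 1 => //; exists 0 => h _; rewrite (zmod_morphism0 (actBl h)) mul0rz.
Qed.

Lemma realizableD A B :
  realizable A -> realizable B -> realizable (fun h => A h + B h).
Proof.
move=> [c c0 [r rA]] [d d0 [s sB]]; exists (c * d); first by rewrite mulf_neq0.
exists (r *~ d + s *~ c) => h hN.
rewrite (zmod_morphismD (actBl h)) !(zmod_morphism_mulrz _ _ (actBl h)).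
by rewrite rA // sB // -!mulrzA mulrzDl [d * c]mulrC.
Qed.

(** The numerator of [q] is absorbed into the ring element, its denominator into [c]. *)
Lemma realizableZ (q : rat) A : realizable A -> realizable (fun h => q *: A h).
Proof.
move=> [c c0 [r rA]]; exists (c * denq q); first by rewrite mulf_neq0.
exists (r *~ numq q) => h hN.
rewrite (zmod_morphism_mulrz _ _ (actBl h)) rA // -!mulrzA.
rewrite -[LHS]scaler_int -[RHS]scaler_int scalerA; congr (_ *: _).
rewrite !intrM -mulrA -{3}[q]divq_num_den [_%:~R * (_ / _)]mulrC divfK //.
by rewrite intr_eq0 denq_eq0.
Qed.

Lemma realizable_sum (I : Type) (s : seq I) (P : pred I) (F : I -> _ -> _) :
  (forall i, P i -> realizable (F i)) ->
  realizable (fun h => \sum_(i <- s | P i) F i h).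
Proof.
move=> rF; elim: s => [|i s IH].
  by apply: realizable_ext realizable0 => h _; rewrite big_nil.
case Pi: (P i); last by apply: realizable_ext IH => h _; rewrite big_cons Pi.
by apply: realizable_ext (realizableD (rF i Pi) IH) => h _; rewrite big_cons Pi.
Qed.

(** [B] has to respect the degree bound because the element representing [A] is only controlled
    below degree [N]. *)
Lemma realizable_comp A B : (forall h, mdeg_lt N h -> mdeg_lt N (B h)) ->
  realizable A -> realizable B -> realizable (fun h => A (B h)).
Proof.
move=> NB [c c0 [r rA]] [d d0 [s sB]]; exists (c * d); first by rewrite mulf_neq0.
exists (r * s) => h hN; rewrite -actA sB // (zmod_morphism_mulrz _ _ (actBr r)).
by rewrite rA ?mulrzA //; exact: NB.
Qed.

Lemma realizable_id : realizable id.
Proof. by exists 1 => //; exists 1 => h _; rewrite act1. Qed.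
End Realizable.

Section Transfer.
Variables (R S : comNzRingType) (n : nat).
Variable act : R -> {mpoly rat[n]} -> {mpoly rat[n]}.
Variable bct : S -> {mpoly rat[n]} -> {mpoly rat[n]}.

(** A bound valid for both [f] and [h] yields a single [r] acting on each as a nonzero multiple of
    [s]; polynomials over the rationals are torsion-free, so vanishing transfers. *)
Lemma realizable_ann (f h : {mpoly rat[n]}) :
    (forall N s, realizable act N (bct s)) ->
    (forall r, (act r f == 0) = (act r h == 0)) ->
  forall s, (bct s f == 0) = (bct s h == 0).
Proof.
move=> rl fh s; have [c c0 [r rA]] := rl (maxn (msize f) (msize h)) s.
have ltN p : (msize p <= maxn (msize f) (msize h))%N ->
    mdeg_lt (maxn (msize f) (msize h)) p.
  by move=> le_p m le_m; apply: mdeg_lt_msize (leq_trans le_p le_m).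
by rewrite -(mpoly_mulrz_eq0 _ c0) -rA ?fh ?rA ?mpoly_mulrz_eq0 //; apply: ltN;
  rewrite ?leq_maxl ?leq_maxr.
Qed.
End Transfer.

(** * Shifts and derivatives in terms of each other *)

Lemma bcoord_bvecMz n (L : zmodType) (b : lattice_basis n L) i (z : int) j :
  bcoord b (b i *~ z) j = (i == j)%:R * z.
Proof.
have -> : b i *~ z = \sum_k b k *~ ((i == k)%:R * z).
  rewrite (bigD1 i) //= eqxx mul1r big1 ?addr0 // => k ne_ki.
  by rewrite eq_sym (negbTE ne_ki) mul0r.
exact: (bcoord_dual b (fun k => (i == k)%:R * z) j).
Qed.

Section Shift.
Variables (n : nat) (L : zmodType) (b : lattice_basis n L).

Lemma shift_translate i (z : int) h :
  shift b (b i *~ z) h = translate i z%:~R h.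
Proof.
rewrite /shift /translate; congr (_ \mPo _); apply: eq_mktuple => j.
by rewrite bcoord_bvecMz intrM; case: (i == j).
Qed.

Lemma lattice_ind (P : L -> Prop) :
    P 0 -> (forall v w, P v -> P w -> P (v + w)) ->
    (forall i, P (b i)) -> (forall i, P (- b i)) ->
  forall v, P v.
Proof.
move=> P0 PD Pb PNb v; rewrite (bvec_decomp b v); elim/big_ind: _ => // i _.
have Pn x k : P x -> P (x *+ k).
  by move=> Px; elim: k => [|k IH] //; rewrite mulrS; apply: PD.
case: (bcoord b v i) => k; first exact: Pn.
by rewrite NegzE mulrNz -mulNrn; apply: Pn.
Qed.

Lemma shift_realizable N v : realizable (@diff_act n) N (shift b v).
Proof.
have Bl := @diff_actBl n; have Br := @diff_actBr n.
have rb i (z : int) : realizable (@diff_act n) N (shift b (b i *~ z)).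
  apply: realizable_ext (_ : realizable _ _ (fun h =>
    \sum_(k < N) (z%:~R ^+ k / k`!%:R) *: h^`M(i, k))) => [h hN|].
    by rewrite shift_translate (taylor _ _ hN).
  apply: realizable_sum => // k _; apply: realizableZ => //.
  exists 1 => //; exists 'X_[U_(i) *+ k] => h _.
  by rewrite diff_actX.
(* A nonzero multiple of [A h] is a combination of derivatives of [h], so [A] respects the degree
   bound, as composition requires. *)
have deg A h : realizable (@diff_act n) N A -> mdeg_lt N h -> mdeg_lt N (A h).
  move=> [c c0 [d dA]] hN; apply: (mdeg_ltMz_inv c0); rewrite -dA //.
  rewrite /diff_act; elim/big_ind: _ => [||m _]; first exact: mdeg_lt0.
    by move=> *; apply: mdeg_ltD.
  exact/mdeg_ltMz/mdeg_lt_mderivm.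
elim/lattice_ind: v => [|v w rv rw|i|i].
- by apply: realizable_ext (realizable_id (@diff_act1 n) N) => h _; rewrite shift0.
- apply: realizable_ext (realizable_comp Br (@diff_actA n) _ rv rw) => [h _|h].
    by rewrite shiftD.
  exact: deg.
- exact: (rb i 1).
- exact: (rb i (-1)).
Qed.

Lemma sh_act_realizable N s : realizable (@diff_act n) N (@sh_act n L b s).
Proof.
rewrite /sh_act /fgsum; apply: realizable_sum; first exact: diff_actBl.
move=> v _; apply: realizable_ext (realizableZ (@diff_actBl n)
  (freeg.coeff v s)%:~R (shift_realizable N v)) => h _.
by rewrite scaler_int.
Qed.

(* [w] is a column of the inverse Vandermonde matrix of the nodes 0, ..., K.+1. *)
Lemma derivative_weights K : exists w : 'I_K.+2 -> rat,
  forall k : 'I_K.+2, \sum_j w j * (j%:R) ^+ k = (k == 1 :> nat)%:R.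
Proof.
pose a : 'rV[rat]_K.+2 := \row_j j%:R; pose V := Vandermonde K.+2 a.
have V_unit : V \in unitmx.
  rewrite unitmxE unitfE det_Vandermonde; apply/prodf_neq0 => i _.
  apply/prodf_neq0 => j lt_ij; rewrite !mxE subr_eq0 eqr_nat.
  by rewrite neq_ltn lt_ij orbT.
pose w := invmx V *m \col_k (k == 1 :> nat)%:R.
exists (fun j => w j 0) => k.
have /matrixP /(_ k 0) : V *m w = \col_k (k == 1 :> nat)%:R by rewrite mulKVmx.
rewrite !mxE => <-; apply: eq_bigr => j _.
by rewrite !mxE mulrC.
Qed.

(** Taylor expansions at 0, 1, ..., N+1 are combined with weights that cancel every order except the
    first. *)
Lemma mderiv_realizable N i : realizable (@sh_act n L b) N (mderiv i).
Proof.
have [w wE] := derivative_weights N.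
have Bl := @sh_actBl n L b.
apply: realizable_ext (_ : realizable _ _ (fun h =>
    \sum_j w j *: shift b (b i *~ Posz j) h)) => [h hN|]; last first.
  apply: realizable_sum => // j _; apply: realizableZ => //.
  by exists 1 => //; exists (Tr (b i *~ Posz j)) => h _; rewrite sh_actTr.
(* Relaxing the bound to [N.+2] matches the number of nodes and guarantees that order 1 occurs even
   when [N] is 0. *)
have hN2 : mdeg_lt N.+2 h by move=> m Nm; apply: hN; do 2!apply: ltnW.
under eq_bigr => j _.
  rewrite shift_translate (taylor _ _ hN2) scaler_sumr.
  under eq_bigr do rewrite scalerA mulrA.
over.
rewrite exchange_big /=.
under eq_bigr => k _ do rewrite -scaler_suml -mulr_suml wE.
rewrite (bigD1 (Ordinal (isT : (1 < N.+2)%N))) //= big1 => [|k].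
  by rewrite addr0 mulm1n mderivmU1m divr1 scale1r.
by rewrite -val_eqE /= => /negbTE ->; rewrite mul0r scale0r.
Qed.

Lemma diff_act_realizable N d : realizable (@sh_act n L b) N (@diff_act n d).
Proof.
have Bl := @sh_actBl n L b.
rewrite /diff_act; apply: realizable_sum => // m _.
suff rm : realizable (@sh_act n L b) N (mderivm m).
  apply: realizable_ext (realizableZ Bl (d@_m)%:~R rm) => h _.
  by rewrite scaler_int.
(* [mderivm] iterates partial derivatives, over the variables and then over each exponent; both
   iterations are followed by induction. *)
rewrite /mderivm; elim: (enum _) => [|i s IH] /=.
  exact: realizable_id (@sh_act1 n L b) N.
elim: (m i) => [|k IHk] //=.
apply: (realizable_comp (@sh_actBr n L b) (@sh_actA n L b)) => //.
  move=> h hN; elim: k {IHk} => [|k IHk] /=; last exact: mdeg_lt_mderiv.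
  elim: s {IH} => [|j s IH] //=; elim: (m j) => [|k IHk] //=.
  exact: mdeg_lt_mderiv.
exact: mderiv_realizable.
Qed.

Lemma diff_equiv_Ann_sh (f h : {mpoly rat[n]}) :
  diff_equiv f h <-> Ann (f : poly_sh b) =i Ann (h : poly_sh b).
Proof.
split=> fh r.
  exact: (realizable_ann (fun N => sh_act_realizable N) fh r).
exact: (realizable_ann (fun N => diff_act_realizable N) fh r).
Qed.
End Shift.

(** * The Pochhammer transforms and translations *)

Section Pochhammer.
Variables (n : nat) (e : int).
Implicit Types (i : 'I_n) (m : 'X_{1..n}) (p : {mpoly rat[n]}).

(* [e = 1] gives the falling transform, [e = -1] the rising one. *)
Definition poch_power i k : {mpoly rat[n]} :=
  \prod_(j < k) ('X_i - (e%:~R * j%:R)%:MP).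

Definition poch_mon m := \prod_i poch_power i (m i).

Definition poch p := \sum_(m <- msupp p) p@_m *: poch_mon m.

(** An index set not depending on [p] allows sums for different polynomials to be compared term by
    term, whence linearity. *)
Lemma pochwE k p : (msize p <= k)%N ->
  poch p = \sum_(m : 'X_{1..n < k}) p@_m *: poch_mon m.
Proof.
move=> le_pk; rewrite /poch (big_mksub ('X_{1..n < k})) /=; first last.
- by move=> x /msize_mdeg_lt/leq_trans/(_ le_pk).
- by rewrite msupp_uniq.
by rewrite big_rmcond //= => m /memN_msupp_eq0 ->; rewrite scale0r.
Qed.

Lemma poch_is_linear : linear poch.
Proof.
move=> c p q; pose k := maxn (msize (c *: p + q)) (maxn (msize p) (msize q)).
rewrite !(@pochwE k) ?leq_max ?leqnn ?orbT // scaler_sumr -big_split /=.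
by apply: eq_bigr => m _; rewrite mcoeffD mcoeffZ scalerDl scalerA.
Qed.

HB.instance Definition _ := GRing.isLinear.Build rat {mpoly rat[n]}
  {mpoly rat[n]} _ poch poch_is_linear.

Lemma pochX m : poch 'X_[m] = poch_mon m.
Proof. by rewrite /poch msuppX big_seq1 mcoeffX eqxx scale1r. Qed.

(** For positive [k], translation moves each factor onto its predecessor: the two products share
    [poch_power i k.-1], and the remaining factors differ by [e * k]. For [k = 0] the coefficient
    vanishes, so the truncated [k.-1] is harmless. *)
Lemma translate_poch_power i k :
  translate i e%:~R (poch_power i k) =
    poch_power i k + (e%:~R * k%:R) *: poch_power i k.-1.
Proof.
case: k => [|k]; rewrite /poch_power.
  by rewrite !big_ord0 rmorph1 mulr0 scale0r addr0.
rewrite rmorph_prod /=.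
under eq_bigr => j _.
  rewrite rmorphB /= translateXU eqxx mul1r translateC.
over.
rewrite big_ord_recl big_ord_recr /= mulr0 mpolyC0 subr0.
have -> : \prod_(i0 < k) ('X_i + (e%:~R)%:MP_[n]
    - (e%:~R * (bump 0 i0)%:R)%:MP) = poch_power i k.
  apply: eq_bigr => j _; rewrite /bump /= add1n -natr1 mulrDr mulr1 mpolyCD.
  by rewrite [X in _ - X]addrC opprD addrA addrK.
rewrite -/(poch_power i k) -mul_mpolyC.
have -> : e%:~R * k.+1%:R = e%:~R * k%:R + e%:~R :> rat.
  by rewrite -natr1 mulrDr mulr1.
by rewrite mpolyCD; ring.
Qed.

Lemma translate_poch_power_neq i j k : i != j ->
  translate i e%:~R (poch_power j k) = poch_power j k.
Proof.
move=> ne_ij; rewrite rmorph_prod /=; apply: eq_bigr => l _.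
by rewrite rmorphB /= translateXU translateC (negbTE ne_ij) mul0r addr0.
Qed.

(** For [e = 1] this is the forward difference rule for falling factorials, for [e = -1] the
    backward rule for rising ones. On a monomial only the factor in the variable [i] moves. *)
Lemma translate_poch i p :
  translate i e%:~R (poch p) = poch (p + p^`M(i) *~ e).
Proof.
rewrite raddfD raddfMz /= -scaler_int.
elim/mpolyind: p => [|c m p _ _ IH]; first by rewrite !raddf0 addr0.
rewrite mderivD mderivZ !linearD !linearZ /= IH.
suff -> : translate i e%:~R (poch 'X_[m]) = poch 'X_[m] + e%:~R *: poch 'X_[m]^`M(i).
  by rewrite scalerDr addrACA.
rewrite mderivX linearZ /= scalerA.
rewrite !pochX /poch_mon (bigD1 i) //= rmorphM /= translate_poch_power.
rewrite rmorph_prod /=.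
rewrite (eq_bigr (fun j => poch_power j (m j))) => [|j ne_ji]; last first.
  by rewrite translate_poch_power_neq // eq_sym.
rewrite mulrDl; congr (_ + _); rewrite -scalerAl; congr (_ *: _).
rewrite [RHS](bigD1 i) //= mnmBE mnm1E eqxx subn1; congr (_ * _).
apply: eq_bigr => j ne_ji.
by rewrite mnmBE mnm1E eq_sym (negbTE ne_ji) subn0.
Qed.

(** Each nonempty Pochhammer product contains the factor ['X_i] coming from [j = 0], so only the
    constant monomial contributes. *)
Lemma mcoeff0_poch p : (poch p)@_0 = p@_0.
Proof.
rewrite [p in RHS]mpolyE !raddf_sum /=; apply: eq_bigr => m _.
rewrite !mcoeffZ mcoeffX; congr (_ * _).
have [->|] := eqVneq m 0%MM.
  rewrite /poch_mon big1 ?mcoeff1 ?eqxx // => i _.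
  by rewrite mnm0E /poch_power big_ord0.
move=> m0; have [i mi] : exists i, (0 < m i)%N.
  apply/existsP; apply: contraNT m0; rewrite negb_exists => /forallP mi.
  by apply/eqP/mnmP => i; rewrite mnm0E; apply/eqP; rewrite -leqn0 leqNgt mi.
rewrite /poch_mon (bigD1 i) //= rmorphM /= /poch_power rmorph_prod /=.
case: (m i) mi => // k _; rewrite big_ord_recl /= mulr0 mpolyC0 subr0 mcoeffX.
by rewrite mnm1_eq0 mul0r mul0r.
Qed.

Lemma poch_inj : e != 0 -> injective poch.
Proof.
move=> e0 p q /eqP; rewrite -subr_eq0 -raddfB /= => /eqP pq0.
apply/eqP; rewrite -subr_eq0; apply/eqP; set r := p - q in pq0 *.
have d0 i h : poch h = 0 -> poch h^`M(i) = 0.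
  move=> h0; apply/eqP; rewrite -(mpoly_mulrz_eq0 _ e0) -raddfMz /=.
  by rewrite -[_ *~ _](addKr h) addrC raddfB /= h0 subr0 -translate_poch h0 raddf0.
have dm0 m : poch r^`M[m] = 0.
  rewrite /mderivm; elim: (enum _) => [|i s IH] //=.
  by elim: (m i) => [|k IHk] //=; exact: d0.
apply/mpolyP=> m; rewrite mcoeff0.
have /eqP := mcoeff0_poch r^`M[m]; rewrite dm0 mcoeff0 mcoeff_mderivm addm0.
rewrite eq_sym mulrn_eq0 => /orP[|/eqP //]; rewrite prod_nat_seq_eq0.
by case/hasP => i _; rewrite /= ffactnn -leqn0 leqNgt fact_gt0.
Qed.
End Pochhammer.

(** * Kernel and image of the homomorphism from Sh(L) to A_g *)

Lemma quo_eq0 (R : comNzRingType) (M : lmodType R) (x : M) r :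
  (quo x r == 0) = (r \in Ann x).
Proof. by rewrite -(raddf0 (quo x)) quo_eq subr0. Qed.

Section ShiftPoch.
Variables (n : nat) (L : zmodType) (b : lattice_basis n L) (g : {mpoly rat[n]}).
Variable e : int.
Hypothesis ee : e * e = 1.
Variable phi : {rmorphism Sh L -> Ag g}.
Hypothesis phiE : forall i, phi (Tr (b i *~ e)) = 1 + dcls g i *~ e.
Implicit Types (s t : Sh L) (d q : {mpoly int[n]}).

Local Notation D q := (diff_act q (g : poly_diff n)).
Local Notation shP s q := (sh_act s (poch e (D q) : poly_sh b)).

(** By commutativity, operators that agree on [g] agree on all derivatives of [g]. *)
Lemma diff_act_quo d d' q :
  quo (g : poly_diff n) d = quo _ d' -> D (d * q) = D (d' * q).
Proof.
move/eqP; rewrite quo_eq => /(AnnM q); rewrite AnnE mulrC mulrBl.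
by move/eqP => dd'; apply/eqP; rewrite -subr_eq0 -diff_actBl; apply/eqP.
Qed.

(* [poch e] intertwines [s] with [phi s] on the module generated by [g]. *)
Definition lifted s := forall q, shP s q = poch e (D (repr (phi s) * q)).

(** Any representative of [phi s] may replace the canonical one, which is not multiplicative. *)
Lemma lifted_intro s d : phi s = quo _ d ->
  (forall q, shP s q = poch e (D (d * q))) -> lifted s.
Proof.
move=> sd ls q; rewrite ls; congr (poch e _); apply: diff_act_quo.
by rewrite quo_surj.
Qed.

Lemma lifted1 : lifted 1.
Proof.
by apply: (@lifted_intro _ 1); rewrite ?rmorph1 // => q; rewrite sh_act1 mul1r.
Qed.

Lemma liftedM s t : lifted s -> lifted t -> lifted (s * t).
Proof.
move=> ls lt; apply: (@lifted_intro _ (repr (phi s) * repr (phi t))).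
  by rewrite !rmorphM /= !quo_surj.
by move=> q; rewrite -sh_actA lt ls mulrA.
Qed.

(** No formula for [phi t] is needed: [D q] is rewritten with the product of the representatives of
    [phi s] and [phi t], the first is pulled out of [poch e] as [s], and [t] cancels it. *)
Lemma lifted_inv s t : s * t = 1 -> lifted s -> lifted t.
Proof.
move=> st ls q; set ds := repr (phi s); set dt := repr (phi t).
have -> : D q = D ((ds * dt) * q).
  rewrite -{1}[q]mul1r; apply: diff_act_quo.
  by rewrite rmorphM /= !quo_surj -rmorphM st !rmorph1.
by rewrite -mulrA -ls sh_actA mulrC st sh_act1.
Qed.

Lemma lifted_gen i : lifted (Tr (b i *~ e)).
Proof.
apply: (@lifted_intro _ (1 + 'X_i *~ e)).
  by rewrite phiE rmorphD rmorph1 rmorphMz.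
move=> q; rewrite sh_actTr shift_translate translate_poch; congr (poch e _).
rewrite mulrDl mul1r (zmod_morphismD (diff_actBl _)) mulrzAl.
rewrite (zmod_morphism_mulrz _ _ (diff_actBl _)) -diff_actA diff_actX.
by rewrite mderivmU1m.
Qed.

Lemma liftedTr v : lifted (Tr v).
Proof.
have gen x : lifted (Tr x) -> lifted (Tr (- x)).
  by apply: lifted_inv; rewrite -TrD subrr.
have gene i k : k = e \/ k = - e -> lifted (Tr (b i *~ k)).
  by case=> ->; rewrite ?mulrNz; [|apply: gen]; apply: lifted_gen.
(* As [e] is a sign, [b i *~ e] and its opposite are exactly the generators [b i] and [- b i]. *)
have e1 : (e == 1) || (e == -1).
  by rewrite -eqf_sqr expr2 ee expr1n.
elim/(lattice_ind (b := b)): v => [|v w lv lw|i|i].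
- exact: lifted1.
- by rewrite TrD; apply: liftedM.
- by apply: (gene i 1); case/orP: e1 => /eqP ->; [left|right].
- by apply: (gene i (-1)); case/orP: e1 => /eqP ->; [right|left].
Qed.

Lemma lifted_all s : lifted s.
Proof.
move=> q; move: s; apply: sh_ext => [|s t|v]; last exact: liftedTr.
  exact: sh_actBl.
rewrite -raddfB -diff_actBl -mulrBl; congr (poch e _); apply: diff_act_quo.
by rewrite [in RHS]raddfB /= !quo_surj raddfB.
Qed.

Lemma e_neq0 : e != 0.
Proof. by apply/eqP => e0; move: ee; rewrite e0. Qed.

(** The intertwining relation at [q = 1] reads s (P g) = P (phi(s) g), and P is injective. *)
Lemma phi_eq0 s : (phi s == 0) = (s \in Ann (poch e g : poly_sh b)).
Proof.
have := lifted_all s 1; rewrite diff_act1 mulr1 AnnE => E.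
rewrite -[phi s]quo_surj quo_eq0 AnnE.
apply/eqP/eqP => [d0|s0].
  by rewrite [LHS]E [diff_act _ _]d0 raddf0.
by apply: (poch_inj e_neq0); rewrite raddf0 -E.
Qed.

Lemma phi_surj a : exists s, phi s == a.
Proof.
rewrite -[a]quo_surj; elim/mpolyint_ind: (repr a) => [|p q|p q|i].
- by exists 1; rewrite !rmorph1.
- by move=> [s /eqP sp] [t /eqP tq]; exists (s - t); rewrite !rmorphB /= sp tq.
- by move=> [s /eqP sp] [t /eqP tq]; exists (s * t); rewrite !rmorphM /= sp tq.
(* Solves [phi (Tr (b i *~ e)) = 1 + dcls g i *~ e] for [dcls g i], using [e * e = 1]. *)
exists ((Tr (b i *~ e) - 1) *~ e).
by rewrite rmorphMz rmorphB /= phiE rmorph1 addrC addKr -mulrzA ee.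
Qed.

Section Induced.
Variable f : {mpoly rat[n]}.
Hypothesis fg : Ann (f : poly_sh b) =i Ann (poch e g : poly_sh b).

Definition induced (q : Kf b f) : Ag g := phi (repr q).

Lemma induced_quo s : induced (quo _ s) = phi s.
Proof.
apply/eqP; rewrite -subr_eq0 -raddfB phi_eq0 -fg -quo_eq0 raddfB /=.
by rewrite quo_surj subrr.
Qed.

Fact induced_zmod_morphism : zmod_morphism induced.
Proof.
move=> p q; rewrite -[p]quo_surj -[q]quo_surj -raddfB.
by rewrite [LHS]induced_quo raddfB !induced_quo.
Qed.

Fact induced_monoid_morphism : monoid_morphism induced.
Proof.
split=> [|p q]; first by rewrite -(rmorph1 (quo _)) [LHS]induced_quo rmorph1.
rewrite -[p]quo_surj -[q]quo_surj -rmorphM.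
by rewrite [LHS]induced_quo rmorphM !induced_quo.
Qed.

Lemma induced_bij : bijective induced.
Proof.
(* The inverse takes the class of a chosen preimage under [phi]; the equality of annihilators makes
   this class independent of the choice. *)
exists (fun a => quo _ (xchoose (phi_surj a))) => [q|a].
  apply/eqP; rewrite -[X in _ == X]quo_surj quo_eq fg -phi_eq0 raddfB subr_eq0.
  exact: (xchooseP (phi_surj (induced q))).
by rewrite induced_quo; apply/eqP; exact: (xchooseP (phi_surj a)).
Qed.
End Induced.

(** Since [phi] is always onto, only its kernel matters: it must coincide with the kernel of the
    projection onto K_f. *)
Lemma induced_isoP (f : {mpoly rat[n]}) :
  (exists psi : {rmorphism Kf b f -> Ag g},
    (forall s, phi s = psi (quo (f : poly_sh b) s)) /\ bijective psi) <->
  Ann (f : poly_sh b) =i Ann (poch e g : poly_sh b).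
Proof.
split=> [[psi [phipsi bij]] s|fg].
  rewrite -[RHS]phi_eq0 phipsi -quo_eq0; apply/esym.
  exact: raddf_eq0 (bij_inj bij).
pose mz := GRing.isZmodMorphism.Build _ _ _ (induced_zmod_morphism fg).
pose mm := GRing.isMonoidMorphism.Build _ _ _ (induced_monoid_morphism fg).
pose psi : {rmorphism Kf b f -> Ag g} := HB.pack (@induced f) mz mm.
exists psi; split=> [s|]; last exact: induced_bij.
by rewrite [RHS](induced_quo fg).
Qed.
End ShiftPoch.

(** * Homomorphisms from Sh(L) with prescribed invertible values *)

Section ShEval.
Variables (n : nat) (L : zmodType) (b : lattice_basis n L) (S : comPzRingType).
Variables a a' : 'I_n -> S.
Hypothesis aa' : forall i, a i * a' i = 1.

(** Integer powers of [a i], with the inverse [a' i] supplied as data; [Negz k] stands for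
    -(k+1). *)
Definition exprz_pair i (z : int) : S :=
  match z with Posz k => a i ^+ k | Negz k => a' i ^+ k.+1 end.

(** Writing integers as differences of naturals spares [exprz_pairD] a case analysis on signs. *)
Lemma exprz_pairB i (p q : nat) :
  exprz_pair i (p%:Z - q%:Z) = a i ^+ p * a' i ^+ q.
Proof.
have aa'k k : a i ^+ k * a' i ^+ k = 1 by rewrite -exprMn aa' expr1n.
have [le_qp|lt_pq] := leqP q p.
  by rewrite -(subnK le_qp) PoszD addrK exprD -mulrA aa'k mulr1.
rewrite -(subnKC lt_pq) addSn -addnS.
rewrite PoszD opprD addrA subrr sub0r -NegzE /= exprD mulrA aa'k mul1r.
by [].
Qed.

Lemma exprz_pairD i x y :
  exprz_pair i (x + y) = exprz_pair i x * exprz_pair i y.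
Proof.
have int_sub (z : int) : exists p q : nat, z = p%:Z - q%:Z.
  case: z => k; first by exists k, 0; rewrite subr0.
  by exists 0, k.+1; rewrite NegzE sub0r.
have [p [q ->]] := int_sub x; have [r [s ->]] := int_sub y.
rewrite addrACA -opprD -!PoszD !exprz_pairB !exprD.
by rewrite mulrACA.
Qed.

Definition sh_eval (s : Sh L) : S :=
  fgsum (fun v => \prod_i exprz_pair i (bcoord b v i)) s.

Lemma sh_evalTr v : sh_eval (Tr v) = \prod_i exprz_pair i (bcoord b v i).
Proof. exact: fgsumU. Qed.

Fact sh_eval_zmod_morphism : zmod_morphism sh_eval.
Proof. by move=> s t; rewrite /sh_eval raddfB. Qed.

Fact sh_eval_monoid_morphism : monoid_morphism sh_eval.
Proof.
split; first by rewrite -Tr0 sh_evalTr big1 // => i _; rewrite bcoord0.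
move=> s t; have hB := sh_eval_zmod_morphism; move: s.
apply: sh_ext => [s s'|s s'|v]; [by rewrite mulrBl hB|by rewrite hB mulrBl|].
move: t; apply: sh_ext => [t t'|t t'|w];
  [by rewrite mulrBr hB|by rewrite hB mulrBr|].
rewrite -TrD !sh_evalTr -big_split /=; apply: eq_bigr => i _.
by rewrite bcoordD exprz_pairD.
Qed.

Lemma sh_eval_basis i : sh_eval (Tr (b i)) = a i.
Proof.
rewrite sh_evalTr (bigD1 i) //= -[b i]mulr1z bcoord_bvecMz eqxx /= expr1.
rewrite big1 ?mulr1 // => j ne_ji.
by rewrite bcoord_bvecMz eq_sym (negbTE ne_ji).
Qed.
End ShEval.

(** * Nilpotency, inverses, and the two equivalences *)

Lemma dcls_nilpotent n (g : {mpoly rat[n]}) i : dcls g i ^+ (msize g) = 0.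
Proof.
rewrite -rmorphXn /=; apply/eqP; rewrite quo_eq0 AnnE mpolyXn.
apply/eqP; rewrite [LHS]diff_actX; apply: mderivn_mdeg_lt.
exact: mdeg_lt_msize.
Qed.

Lemma geom_inverse (S : comPzRingType) (x : S) K : x ^+ K = 0 ->
  (1 - x) * (\sum_(k < K) x ^+ k) = 1.
Proof.
move=> xK; have := subrX1 x K; rewrite xK sub0r => E.
by rewrite -[1 - x]opprB mulNr -E opprK.
Qed.

Section DefinesIso.
Variables (n : nat) (L : zmodType) (b : lattice_basis n L) (f g : {mpoly rat[n]}).
Variable e : int.
Hypothesis ee : e * e = 1.
Variable a : 'I_n -> Ag g.
Hypothesis aE : forall phi : {rmorphism Sh L -> Ag g},
  (forall i, phi (Tr (b i)) = a i) ->
  forall i, phi (Tr (b i *~ e)) = 1 + dcls g i *~ e.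
Variable a' : 'I_n -> Ag g.
Hypothesis aa' : forall i, a i * a' i = 1.

(** Hypothesis [aE] covers both signs: it restates the assignment when [e = 1] and identifies the
    inverse of [a i] when [e = -1]. The inverses [a'] ensure that the homomorphism exists. *)
Lemma defines_isoP : defines_iso b f a <-> diff_equiv f (poch e g).
Proof.
rewrite (diff_equiv_Ann_sh b); split=> [[phi [phia iso]]|fg].
  by apply/(induced_isoP ee (aE phia)).
pose mz := GRing.isZmodMorphism.Build _ _ _ (sh_eval_zmod_morphism b a a').
pose mm := GRing.isMonoidMorphism.Build _ _ _ (sh_eval_monoid_morphism b aa').
pose phi : {rmorphism Sh L -> Ag g} := HB.pack (sh_eval b a a') mz mm.
have phia i : phi (Tr (b i)) = a i by exact: sh_eval_basis.
by exists phi; split=> //; apply/(induced_isoP ee (aE phia)).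
Qed.
End DefinesIso.

Lemma poch1E n (p : {mpoly rat[n]}) : poch 1 p = poch_fall p.
Proof.
apply: eq_bigr => m _; congr (_ *: _); apply: eq_bigr => i _.
by apply: eq_bigr => j _; rewrite mul1r mpolyC_nat.
Qed.

Lemma pochN1E n (p : {mpoly rat[n]}) : poch (-1) p = poch_rise p.
Proof.
apply: eq_bigr => m _; congr (_ *: _); apply: eq_bigr => i _.
by apply: eq_bigr => j _; rewrite mulN1r mpolyCN opprK mpolyC_nat.
Qed.

(** Inverses are unique, so the [a] in the second part is the single family 1/(1 - d_i). *)
Theorem theorem1p4 (n : nat) (L : zmodType) (u : lattice_basis n L)
    (f g : {mpoly rat[n]}) :
  (defines_iso u f (fun i => 1 + dcls g i) <-> diff_equiv f (poch_fall g)) /\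
  ((exists a : 'I_n -> Ag g,
      (forall i, a i * (1 - dcls g i) = 1) /\ defines_iso u f a)
   <-> diff_equiv f (poch_rise g)).
Proof.
have fall_inv i : (1 + dcls g i) * (\sum_(k < msize g) (- dcls g i) ^+ k) = 1.
  rewrite -{1}[dcls g i]opprK; apply: geom_inverse.
  by rewrite exprNn dcls_nilpotent mulr0.
have rise_inv i := geom_inverse (dcls_nilpotent g i).
have rise (a : 'I_n -> Ag g) : (forall i, a i * (1 - dcls g i) = 1) ->
    defines_iso u f a <-> diff_equiv f (poch_rise g).
  move=> aE; rewrite -pochN1E; apply: (defines_isoP _ _ _ aE) => // phi phia i.
  have inv : phi (Tr (- u i)) * a i = 1.
    by rewrite -phia -rmorphM -TrD addNr rmorph1.
  (* Multiplying [a i * (1 - dcls g i) = 1] by the inverse of [a i] identifies [phi (Tr (- u i))]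
     with [1 - dcls g i]. *)
  have := congr1 (fun x => phi (Tr (- u i)) * x) (aE i).
  by rewrite /= mulrA inv mul1r mulr1 !mulrNz !mulr1z => ->.
split.
  by rewrite -poch1E; apply: (defines_isoP _ _ _ fall_inv).
split=> [[a [aE iso]]|fg]; first exact/(rise a).
(* The geometric series, finite by nilpotency, is the witness for 1/(1 - d_i). *)
have aE i : (\sum_(k < msize g) dcls g i ^+ k) * (1 - dcls g i) = 1.
  by rewrite mulrC.
by exists (fun i => \sum_(k < msize g) dcls g i ^+ k); split=> //; apply/rise.
Qed.
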